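(* Let $n\ge1$, let $\mathcal H\subset\mathbf{RP}^n=\mathbf P(\mathbf R^{n+1})$ be a finite subset and let $\langle u\rangle\in\mathbf{RP}^n\setminus\mathcal H$. Then $$\eta^{\bigstar}_n(\mathcal H\cup\{\langle u\rangle\})=\eta^{\bigstar}_n(\mathcal H)+\eta^{\bigstar}_{n-1}(\mathcal H^{\perp u}),$$ where $\mathcal H^{\perp u}=\{\langle P(w)\rangle : \langle w\rangle\in\mathcal H\}\subset \mathbf P(\langle u\rangle^{\perp})\cong\mathbf{RP}^{n-1}$ and $P:\mathbf R^{n+1}\to\langle u\rangle^\perp$ is the orthogonal projection onto the orthogonal complement of $u$.
   Context: For a real vector space $V$ of dimension $m+1$ let $\mathbf P(V)$ be the set of its $1$-dimensional subspaces; for $v\ne0$ write $\langle v\rangle$ for the line it spans. Let $\mathcal H=\{\langle w_1\rangle,\dots,\langle w_T\rangle\}\subset\mathbf P(V)$ be a finite set of $T$ distinct points, and let an order on $\mathcal H$ be a bijection $\pi:[T]\to\mathcal H$, $\pi(i)=\langle w_i\rangle$. An ordered $m$-tuple $(\langle w_{i_1}\rangle,\dots,\langle w_{i_m}\rangle)$ of distinct elements of $\mathcal H$ satisfies the $\eta^\pi_m(\mathcal H)$ condition if (1) $2\le i_1<\dots<i_m\le T$, and (2) for every $l=1,\dots,m$, $\langle w_{i_l}\rangle$ is the $\pi$-minimal element among all points of $\mathcal H$ contained in $\mathrm{span}(w_{i_l},\dots,w_{i_m})$. Let $B^\pi(\mathcal H)$ be the set of such tuples with $w_{i_1},\dots,w_{i_m}$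 linearly independent. It is a known fact that $|B^\pi(\mathcal H)|$ does not depend on $\pi$; this common value is denoted $\eta^{\bigstar}_m(\mathcal H)$ (defined for finite subsets of $\mathbf P(V)$ for any $(m+1)$-dimensional $V$, in particular for $V=\langle u\rangle^\perp$ with $m=n-1$). *)

(* Defs.v *)
From HB Require Import structures.
From mathcomp Require Import all_boot all_order all_algebra.
From mathcomp Require Import mathcomp_extra boolp classical_sets functions cardinality reals.

Set Implicit Arguments.
Unset Strict Implicit.
Unset Printing Implicit Defensive.

Import Order.TTheory GRing.Theory Num.Theory.

Local Open Scope classical_set_scope.
Local Open Scope ring_scope.

Definition projSpace (R : fieldType) (V : vectType R) : Type :=
  {L : {vspace V} | \dim L == 1%N}.

Lemma dim_line1 (R : fieldType) (V : vectType R) (v : V) :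
  v != 0 -> \dim <[v]>%VS == 1%N.
Proof. by move=> v0; rewrite dim_vline v0. Qed.

Definition line (R : fieldType) (V : vectType R) (v : V) (v0 : v != 0) :
  projSpace V := exist _ <[v]>%VS (dim_line1 v0).

(* A spanning vector of the line [p]; the notions below do not depend on which
   one is picked. *)
Definition gen (R : fieldType) (V : vectType R) (p : projSpace V) : V :=
  vpick (sval p).

(* A tuple of points of [range pi] is encoded by the tuple [t] of its indices.
   Indices start at 0, so the condition 2 <= i_1 < ... < i_m <= T is the strict
   chain 0 < t_0 < ... < t_(m-1) < T.  The conjunct [0 < T] is implied by the
   rest when [m > 0]; when [m = 0] it is what remains of the chain, and the
   empty tuple then satisfies the condition iff there is at least one point. *)
Definition eta_cond (R : fieldType) (V : vectType R) (T m : nat)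
    (pi : 'I_T -> projSpace V) (t : m.-tuple 'I_T) : bool :=
  [&& (0 < T)%N,
      path ltn 0%N [seq val i | i <- t]
    & [forall l : 'I_m, forall j : 'I_T,
        (sval (pi j) <= <<[seq gen (pi i) | i <- drop l t]>>)%VS
          ==> (tnth t l <= j)%N]].

Definition eta_tuples (R : fieldType) (V : vectType R) (T m : nat)
    (pi : 'I_T -> projSpace V) : {set m.-tuple 'I_T} :=
  [set t | eta_cond pi t && free [seq gen (pi i) | i <- t]].

(* The common value of the cardinals over all orders [pi] of the finite set
   [H]; intended for [V] of dimension [m + 1]. *)
Definition eta_star (R : fieldType) (V : vectType R) (m : nat)
    (H : set (projSpace V)) : nat :=
  xget 0%N [set k : nat | forall (T : nat) (pi : 'I_T -> projSpace V),
    set_bij setT H pi -> #|eta_tuples m pi| = k].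

Definition dot (R : fieldType) (n : nat) (v w : 'rV[R]_n) : R :=
  (v *m w^T) 0 0.

Definition orth (R : fieldType) (n : nat) (u : 'rV[R]_n) : {vspace 'rV[R]_n} :=
  lker (linfun (mulmxr u^T : 'rV[R]_n -> 'rV[R]_1)).

Lemma mem_orth (R : fieldType) (n : nat) (u v : 'rV[R]_n) :
  (v \in orth u) = (dot v u == 0).
Proof.
rewrite memv_ker lfunE /= /dot; apply/eqP/eqP => [->|vu0]; first by rewrite mxE.
by apply/matrixP => i j; rewrite !ord1 vu0 mxE.
Qed.

(* [vsproj] is only used here to view a vector of [orth u] as an element of the
   subspace type: see [vsval_orth_proj]. *)
Definition orth_proj (R : fieldType) (n : nat) (u w : 'rV[R]_n) :
  subvs_of (orth u) := vsproj (orth u) (w - (dot w u / dot u u) *: u).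

Lemma vsval_orth_proj (R : realFieldType) (n : nat) (u w : 'rV[R]_n) :
  u != 0 -> vsval (orth_proj u w) = w - (dot w u / dot u u) *: u.
Proof.
move=> u0; rewrite /orth_proj vsprojK // mem_orth.
have dE (x y : 'rV[R]_n) : dot x y = \sum_j x 0 j * y 0 j.
  by rewrite /dot mxE; apply: eq_bigr => j _; rewrite mxE.
have uu0 : dot u u != 0.
  apply: contraNneq u0; rewrite dE => /eqP.
  rewrite psumr_eq0; last by move=> j _; rewrite -expr2 sqr_ge0.
  move=> /allP uj; apply/eqP/rowP => j; rewrite mxE.
  by have := uj j (mem_index_enum j); rewrite mulf_eq0 orbb => /eqP.
have -> : dot (w - (dot w u / dot u u) *: u) u = dot w u - dot w u / dot u u * dot u u.
  by rewrite [in LHS]/dot mulmxBl -scalemxAl [LHS]mxE [X in _ + X]mxE [X in _ - X]mxE.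
by rewrite divfK // subrr.
Qed.

Definition perp (R : fieldType) (n : nat) (H : set (projSpace 'rV[R]_n))
    (u : 'rV[R]_n) : set (projSpace (subvs_of (orth u))) :=
  [set q | exists (w : 'rV[R]_n) (w0 : w != 0),
    H (line w0) /\ sval q = <[orth_proj u w]>%VS].

Arguments perp {R n} H u _.

(* Main.v *)
(* For a finite family L of lines of V put
     W(L) = \sum_S (-1)^|S|,   S ranging over the index sets with span L(S) = V.
   Call e "broken" for S if L e lies in the span of the elements of S coming
   after e.  Toggling the membership of a broken e in S changes neither the span
   of S nor its set of broken elements, so the sets with a broken element cancel
   in W(L).  The remaining ones are bases of V containing the minimal element,
   and removing that element from them gives exactly the tuples counted by eta.
   Hence W(L) = (-1)^(m+1) eta_m(L) for every order (Whitney's broken circuit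
   theorem), which proves that eta_m does not depend on the order.  Splitting
   W(H + u) according to whether u belongs to S gives W(H) minus the W of the
   projected family; the latter may repeat a line, but W only depends on the set
   of lines of the family, again by a toggling argument. *)
Require Import Defs.
From HB Require Import structures.
From mathcomp Require Import all_boot all_order all_algebra.
From mathcomp Require Import mathcomp_extra boolp classical_sets functions cardinality reals.
From mathcomp Require Import zify.

Set Implicit Arguments.
Unset Strict Implicit.
Unset Printing Implicit Defensive.

Import Order.TTheory GRing.Theory Num.Theory.

Local Open Scope classical_set_scope.
Local Open Scope ring_scope.

(** * Sign-reversing toggles on the subsets of a finite type *)

Section Toggle.
Variable I : finType.
Implicit Types (S B : {set I}) (i : I).

Definition toggle i S := if i \in S then S :\ i else i |: S.

Lemma in_toggle i S k : (k \in toggle i S) = (k == i) (+) (k \in S).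
Proof.
by rewrite /toggle; case: ifP => iS; rewrite !inE; case: eqVneq => // ->; rewrite iS.
Qed.

Lemma toggleK i : involutive (toggle i).
Proof. by move=> S; apply/setP => k; rewrite !in_toggle addbA addbb. Qed.

Lemma setD1_toggle i S : toggle i S :\ i = S :\ i.
Proof. by apply/setP => k; rewrite !inE in_toggle; case: eqVneq. Qed.

Lemma toggleI i S B :
  toggle i S :&: B = if i \in B then toggle i (S :&: B) else S :&: B.
Proof.
apply/setP => k; case: ifP => iB; rewrite !(inE, in_toggle);
  by case: eqVneq => // ->; rewrite iB ?andbT ?andbF.
Qed.

Lemma sign_toggle i S : (-1) ^+ #|toggle i S| = - (-1) ^+ #|S| :> int.
Proof.
rewrite (cardsD1 i (toggle i S)) (cardsD1 i S) setD1_toggle in_toggle eqxx.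
by case: (i \in S); rewrite /= ?add0n ?add1n exprS mulN1r ?opprK.
Qed.

(** Toggling does not change the index that [e] selects, so [h] is an involution on the sets
    satisfying [P]. It flips every sign, so the sum is its own opposite. *)
Lemma sum_toggle (P : pred {set I}) (e : {set I} -> option I) :
    (forall S, P S -> exists i,
      [/\ e S = Some i, P (toggle i S) & e (toggle i S) = Some i]) ->
  \sum_(S | P S) (-1) ^+ #|S| = 0 :> int.
Proof.
move=> Pe; pose h S := if e S is Some i then toggle i S else S.
have hP S : P S -> [/\ P (h S), h (h S) = S & (-1) ^+ #|h S| = - (-1) ^+ #|S| :> int].
  by case/Pe => i [eS PS eS']; rewrite /h eS eS' toggleK sign_toggle.
set s := \sum_(S | _) _.
suff : s = - s by lia.
rewrite /s [LHS](reindex_onto h h) => [|S /hP[]//].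
rewrite -sumrN; apply: eq_big => S.
  apply/andP/idP => [[/hP[PhhS _ _] /eqP hhS]|/hP[-> -> _]//].
  by rewrite hhS in PhhS.
by case/andP=> /hP[_ _ sgn] /eqP hhS; rewrite hhS in sgn; rewrite sgn opprK.
Qed.

End Toggle.

(** * The alternating sum over spanning index sets *)

Section Whitney.
Variables (F : fieldType) (V : vectType F).

Definition whitney (I : finType) (L : I -> {vspace V}) : int :=
  \sum_(S : {set I} | (\sum_(i in S) L i)%VS == fullv) (-1) ^+ #|S|.

Section Family.
Variables (I : finType) (L : I -> {vspace V}).
Implicit Types (S B : {set I}).

Lemma sumv_subset S B : S \subset B ->
  (\sum_(i in S) L i <= \sum_(i in B) L i)%VS.
Proof.
move=> sSB; apply/subv_sumP => i iS.
by apply: (sumv_sup i) => //; apply: (fintype.subsetP sSB).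
Qed.

Lemma sumv_setD1 i S : (L i <= \sum_(k in S :\ i) L k)%VS ->
  (\sum_(k in S) L k)%VS = (\sum_(k in S :\ i) L k)%VS.
Proof.
move=> Li; case: (boolP (i \in S)) => iS.
  by rewrite (big_setD1 i) //=; apply/addv_idPr.
apply: eq_bigl => k; rewrite !inE.
by case: eqVneq => // ->; rewrite (negbTE iS).
Qed.

Lemma sumv_toggle i S : (L i <= \sum_(k in S :\ i) L k)%VS ->
  (\sum_(k in toggle i S) L k)%VS = (\sum_(k in S) L k)%VS.
Proof.
by move=> Li; rewrite (sumv_setD1 Li) [LHS](@sumv_setD1 i) ?setD1_toggle.
Qed.

End Family.

(** A section [r] of [q] has a transversal [A] as its image. The subsets of [A] correspond to the
    subsets of [J] and give the right-hand sum; all other sets cancel. *)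
Lemma whitney_comp (I J : finType) (q : I -> J) (L : J -> {vspace V}) :
  (forall j, exists i, q i = j) -> whitney (L \o q) = whitney L.
Proof.
move=> /choice[r rK]; pose A := [set r j | j : J]%SET.
have rA j : r j \in A by apply/imsetP; exists j.
have rSA (S : {set J}) : r @: S \subset A.
  by apply/fintype.subsetP => _ /imsetP[j _ ->].
rewrite /whitney (bigID (fun S : {set I} => S \subset A)) /= addrC.
(* A set S containing some x outside the transversal A is paired with the set
   obtained by toggling the representative of x, which spans the same line. *)
rewrite (@sum_toggle _ _ (fun S => omap (r \o q) [pick x in S :\: A])) ?add0r.
  rewrite (reindex_onto (fun S : {set J} => r @: S) (fun S => r @^-1: S)) /=.
    have ri : injective r by apply: can_inj rK.
    apply: eq_big => [S|S _]; last by rewrite card_imset.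
    rewrite big_imset /=; last by move=> ? ? _ _ /ri.
    under eq_bigr do rewrite rK.
    rewrite rSA andbT; case: eqP => //= _.
    by apply/eqP/setP => j; rewrite inE mem_imset.
  move=> S /andP[_ /fintype.subsetP SA]; apply/setP => i; apply/imsetP/idP.
    by case=> j + ->; rewrite inE.
  by move=> iS; have /imsetP[j _ ij] := SA _ iS; exists j => //; rewrite inE -ij.
move=> S /andP[/eqP Sfull SA].
case Ex: [pick x in S :\: A] => [x|] /=; last first.
  move: Ex; case: pickP => // SA0 _.
  by case/negP: SA; rewrite -finset.setD_eq0; apply/eqP/setP => x; rewrite SA0 !inE.
have /setDP[xS xA] : x \in S :\: A by move: Ex; case: pickP => // ? ? [<-].
exists (r (q x)).
(* The toggled index lies in [A], so the set from which [x] is picked stays the same. *)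
have DA : toggle (r (q x)) S :\: A = S :\: A.
  apply/setP => k; rewrite !inE in_toggle; case: eqVneq => // ->.
  by rewrite rA.
split=> //.
  rewrite -finset.setD_eq0 DA finset.setD_eq0 SA andbT sumv_toggle ?Sfull //.
  apply: (sumv_sup x); last by rewrite /= rK.
  rewrite !inE xS andbT; apply: contraNneq xA => ->; exact: rA.
by rewrite DA Ex.
Qed.

(** * Cancelling the sets with a broken element *)

Section Ordered.
Variables (T : nat) (L : 'I_T -> {vspace V}).
Implicit Types (S : {set 'I_T}) (e i : 'I_T).

Definition above e : {set 'I_T} := [set i : 'I_T | (e < i)%N]%SET.

Definition broken S e := (L e <= \sum_(i in (S :&: above e)%SET) L i)%VS.

(** Short for no broken circuit: for lines, [S] contains no circuit with its least element
    removed. *)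
Definition nbc S := [forall e, ~~ broken S e].

Lemma broken_setD1 i S (B : {set 'I_T}) : broken S i -> above i \subset B ->
  (L i <= \sum_(k in ((S :&: B) :\ i)%SET) L k)%VS.
Proof.
move=> Si /fintype.subsetP iB; apply: (subv_trans Si); apply: sumv_subset.
apply/fintype.subsetP => k; rewrite !inE => /andP[-> ik] /=.
have := iB k; rewrite inE => -> //.
by rewrite andbT; apply: contraTneq ik => ->; rewrite ltnn.
Qed.

(** If [i <= e], toggling [i] does not touch the part of [S] above [e]. If [e < i], that part
    contains all of [S] above [i], whose span already holds [L i], so its span is kept. *)
Lemma broken_toggle i S e : broken S i -> broken (toggle i S) e = broken S e.
Proof.
move=> Si; rewrite /broken toggleI inE; case: ltnP => // ei.
rewrite sumv_toggle //; apply: broken_setD1 => //.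
by apply/fintype.subsetP => k; rewrite !inE; apply: ltn_trans.
Qed.

Lemma whitney_nbc : whitney L =
  \sum_(S : {set 'I_T} | ((\sum_(i in S) L i)%VS == fullv) && nbc S) (-1) ^+ #|S|.
Proof.
rewrite /whitney (bigID nbc) /= [X in _ + X](_ : _ = 0) ?addr0 //.
apply: (@sum_toggle _ _ (fun S => [pick e | broken S e])).
move=> S /andP[/eqP Sfull].
rewrite negb_forall => /existsP[x0 /negPn x0S].
case Ex: [pick e | broken S e] => [x|]; last first.
  by move: Ex; case: pickP => // /(_ x0); rewrite x0S.
have xS : broken S x by move: Ex; case: pickP => // ? ? [<-].
have bE : broken (toggle x S) =1 broken S by move=> e; exact: broken_toggle.
exists x; split=> //; last by rewrite (eq_pick bE).
rewrite sumv_toggle ?Sfull ?eqxx /=.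
  by rewrite negb_forall; apply/existsP; exists x; rewrite negbK bE.
by have := broken_setD1 xS (finset.subsetT _); rewrite finset.setIT.
Qed.

End Ordered.

(** * Broken elements in terms of generating vectors *)

Section Generators.
Variables (T : nat) (v : 'I_T -> V).
Hypothesis v_neq0 : forall i, v i != 0.
Implicit Types (s : seq 'I_T) (e i j : 'I_T).

Lemma brokenE s e : uniq s ->
  broken (fun i => <[v i]>%VS) [set i in s]%SET e =
  (v e \in <<[seq v i | i <- s & (e < i)%N]>>%VS).
Proof.
move=> s_uniq; rewrite /broken -memvE span_def big_map.
rewrite big_uniq ?filter_uniq //=.
suff -> : (\sum_(i in ([set i in s] :&: above e)%SET) <[v i]> =
  \sum_(i in [seq i : 'I_T <- s | (e < i)%N]) <[v i]>)%VS by [].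
by apply: eq_bigl => i; rewrite !inE mem_filter andbC.
Qed.

(** Links broken elements to condition (2) of the eta condition. Induction on [s]: an index before
    the head sees the whole list, any other index sees only part of the tail. *)
Lemma nbc_sortedP s : sorted (relpre val ltn) s ->
  (forall e, v e \notin <<[seq v i | i <- s & (e < i)%N]>>%VS) <->
  free (map v s) /\ forall l, (l < size s)%N -> forall j,
    v j \in <<map v (drop l s)>>%VS -> (nth j s l <= j)%N.
Proof.
elim: s => [_|i s IHs /= i_s].
  by split=> [_|_ e]; [rewrite nil_free|rewrite /= span_nil memv0 v_neq0].
have {}IHs := IHs (path_sorted i_s).
have i_lt k : k \in s -> (i < k)%N.
  have lttr : transitive (relpre val ltn : rel 'I_T) by move=> ? ? ?; apply: ltn_trans.
  by move=> ks; have /allP/(_ k ks) := order_path_min lttr i_s.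
have filterT e : (e <= i)%N -> [seq k : 'I_T <- s | (e < k)%N] = s.
  by move=> ei; apply/all_filterP/allP => k /i_lt; apply: leq_ltn_trans.
split=> [s_nbc|].
  have {}IHs : free [seq v k | k <- s] /\ forall l, (l < size s)%N -> forall j,
      v j \in <<[seq v k | k <- drop l s]>>%VS -> (nth j s l <= j)%N.
    apply/IHs => e; have := s_nbc e.
    case: ltnP => // ei; apply: contra; rewrite (filterT e (ltnW ei)) /= span_cons.
    by apply/subvP/addvSr.
  case: IHs => s_free s_min; split.
    by rewrite free_cons s_free andbT; have := s_nbc i; rewrite ltnn filterT.
  case=> [_ j|l ls j]; last exact: s_min.
  rewrite drop0 /=; apply: contraTT; rewrite -ltnNge => ji.
  by have := s_nbc j; rewrite ji filterT // ltnW.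
(* From the head on, the filter drops the head and induction applies; before it, [e] would
   contradict minimality at position 0. *)
case; rewrite free_cons => /andP[_ s_free] s_min e.
case: ltnP => ei; last first.
  by apply: (proj2 IHs _ e); split=> // l ls j; apply: (s_min l.+1).
rewrite filterT 1?ltnW //; apply: contraTN ei => ve.
by rewrite -leqNgt; apply: (s_min 0%N).
Qed.

End Generators.

Lemma line_gen (p : projSpace V) : sval p = <[gen p]>%VS.
Proof.
have /eqP p1 := svalP p.
have p0 : sval p != 0%VS by rewrite -dimv_eq0 p1.
apply/esym/eqP; rewrite eqEdim -memvE memv_pick /= dim_vline vpick0 p0.
by rewrite p1.
Qed.

Lemma gen_neq0 (p : projSpace V) : gen p != 0.
Proof.
by rewrite -memv0 memvE -line_gen subv0 -dimv_eq0 (eqP (svalP p)).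
Qed.

(** * The surviving sets are the eta tuples with the least index added *)

Section EtaTuples.
Variables (m T : nat) (p : 'I_T.+1 -> projSpace V).
Hypothesis dimV : \dim {:V} = m.+1.

Let v i := gen (p i).
Let L i := sval (p i).

Let v_neq0 i : v i != 0. Proof. exact: gen_neq0. Qed.

Let lttr : transitive (relpre val ltn : rel 'I_T.+1).
Proof. by move=> ? ? ?; apply: ltn_trans. Qed.

Let ltir : irreflexive (relpre val ltn : rel 'I_T.+1).
Proof. by move=> ?; exact: ltnn. Qed.

Lemma nbcP s : uniq s -> nbc L [set i in s]%SET <->
  forall e, v e \notin <<[seq v i | i : 'I_T.+1 <- s & (e < i)%N]>>%VS.
Proof.
move=> s_uniq; split=> [/forallP|] nbc_s.
  move=> e; have := nbc_s e; rewrite -brokenE // /broken /L line_gen.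
  by under eq_bigr do rewrite line_gen.
apply/forallP=> e; have := nbc_s e; rewrite -brokenE // /broken /L line_gen.
by under [in X in _ -> X]eq_bigr do rewrite line_gen.
Qed.

Lemma eta_tuplesP (t : m.-tuple 'I_T.+1) :
  t \in eta_tuples m p <-> sorted (relpre val ltn) (ord0 :: t) /\
    nbc L [set i in ord0 :: t]%SET.
Proof.
(* The index [ord0] exceeds no other, so prepending it alters no filtered list and hence no broken
   element. *)
have E0 (s : seq 'I_T.+1) (e : 'I_T.+1) :
  [seq i : 'I_T.+1 <- ord0 :: s | (e < i)%N] = [seq i : 'I_T.+1 <- s | (e < i)%N] by [].
have pathE : path ltn 0%N [seq val i | i <- t] =
    sorted (relpre val ltn) (ord0 :: t : seq 'I_T.+1).
  exact: (@path_map _ _ (val : 'I_T.+1 -> nat) ltn ord0 t).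
split.
  rewrite inE /eta_cond pathE /= => /andP[/andP[t_sort /forallP t_min] t_free].
  have t0_sort : sorted (relpre val ltn) (ord0 :: t : seq 'I_T.+1) by [].
  split=> //; apply/nbcP; first exact: sorted_uniq t0_sort.
  move=> e; rewrite E0; move: e; apply/nbc_sortedP => //.
    exact: path_sorted t_sort.
  split=> // l; rewrite size_tuple => lm j vj.
  have /forallP/(_ j)/implyP := t_min (Ordinal lm).
  rewrite (tnth_nth j) /=; apply.
  by rewrite line_gen -memvE.
case=> t0_sort /(nbcP (sorted_uniq lttr ltir t0_sort)) nbc0.
have t_sort := path_sorted t0_sort.
have /(nbc_sortedP v_neq0 t_sort)[t_free t_min] :
    forall e, v e \notin <<[seq v i | i : 'I_T.+1 <- t & (e < i)%N]>>%VS.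
  by move=> e; rewrite -E0.
rewrite inE /eta_cond t_free pathE t0_sort ltn0Sn andbT.
apply/forallP => l; apply/forallP => j; apply/implyP; rewrite line_gen -memvE => vj.
by rewrite (tnth_nth j); apply: t_min; rewrite ?size_tuple.
Qed.

(** Without broken elements the generators are free, so the dimension of their span is the length of
    the list. *)
Lemma sorted_nbc_full (s : seq 'I_T.+1) : sorted (relpre val ltn) s ->
  nbc L [set i in s]%SET ->
  (\sum_(i in [set i in s]%SET) L i == fullv)%VS = (size s == m.+1).
Proof.
move=> s_sort; have s_uniq := sorted_uniq lttr ltir s_sort.
move=> /(nbcP s_uniq)/(nbc_sortedP v_neq0 s_sort)[s_free _].
have -> : (\sum_(i in [set i in s]%SET) L i = <<map v s>>)%VS.
  rewrite span_def big_map big_uniq //=.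
  by apply: eq_big => i; [rewrite inE | rewrite /L line_gen].
have dims : \dim <<map v s>> = size s by rewrite (eqnP s_free) size_map.
have := dimvS (subvf <<map v s>>); rewrite eqEdim subvf dimV dims /=.
by rewrite [in RHS]eqn_leq => ->.
Qed.

Lemma sorted_enum (S : {set 'I_T.+1}) : sorted (relpre val ltn) (enum S).
Proof.
rewrite /enum_mem -enumT; apply: (sorted_filter lttr).
by rewrite -sorted_map val_enum_ord iota_ltn_sorted.
Qed.

Lemma nbc_full_card (S : {set 'I_T.+1}) :
  (\sum_(i in S) L i)%VS == fullv -> nbc L S -> #|S| = m.+1.
Proof.
move=> S_full S_nbc; rewrite cardE; apply/eqP.
by rewrite -sorted_nbc_full ?sorted_enum // set_enum.
Qed.

Lemma full_nbcE (S : {set 'I_T.+1}) :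
  ((\sum_(i in S) L i)%VS == fullv) && nbc L S =
  (S \in [set [set i in ord0 :: t]%SET | t : m.-tuple _ in eta_tuples m p]%SET).
Proof.
apply/andP/imsetP => [[S_full S_nbc]|[t /eta_tuplesP[t_sort t_nbc] ->]]; last first.
  by rewrite sorted_nbc_full //= size_tuple.
(* Otherwise all of [S] lies above [ord0], and since [S] spans the whole space, [ord0] would be
   broken. *)
have S0 : ord0 \in S.
  move/forallP: S_nbc => /(_ ord0); apply: contraNT => S0.
  rewrite /broken (_ : S :&: above ord0 = S) ?(eqP S_full) ?subvf //.
  apply/setP => i; rewrite !inE /=; case: (unliftP ord0 i) => [j|] ->.
    by rewrite lift0 andbT.
  by rewrite (negbTE S0).
have := sorted_enum S; have := nbc_full_card S_full S_nbc.
have := S0; rewrite -mem_enum cardE; have := set_enum S.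
case: (enum S) => // i s sS /[!inE] i0 [s_size] is_sort.
have i_lt k : k \in s -> (i < k)%N.
  by move=> ks; have /allP/(_ k ks) := order_path_min lttr is_sort.
have ei : i = ord0 by case/orP: i0 => [/eqP //|/i_lt].
rewrite {}ei {i_lt i0} in sS is_sort.
have /eqP s_size' := s_size.
exists (Tuple s_size') => //.
by apply/eta_tuplesP; rewrite /= sS.
Qed.

Lemma whitney_eta_tuples : whitney L = (-1) ^+ m.+1 * #|eta_tuples m p|%:Z.
Proof.
rewrite whitney_nbc.
under eq_bigr => S /andP[S_full S_nbc] do rewrite nbc_full_card //.
under eq_bigl => S do rewrite full_nbcE.
rewrite big_const iter_addr_0 -mulr_natr natz; congr (_ * Posz _).
(* A strictly increasing list is determined by its set of entries, so distinct tuples give distinct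
   sets. *)
rewrite card_in_imset // => t t' /eta_tuplesP[t_sort _] /eta_tuplesP[t'_sort _] /setP tt'.
have [] : ord0 :: t = ord0 :: t' :> seq _; last exact: val_inj.
apply: (irr_sorted_eq lttr ltir) => // i; by have := tt' i; rewrite !inE.
Qed.

End EtaTuples.

Lemma whitney_eta (m T : nat) (p : 'I_T -> projSpace V) : \dim {:V} = m.+1 ->
  whitney (fun i => sval (p i)) = (-1) ^+ m.+1 * #|eta_tuples m p|%:Z.
Proof.
move=> dimV; case: T p => [p|T p]; last exact: whitney_eta_tuples.
(* With no points both sides vanish: the empty span is not the whole space, and the conjunct [0 < T]
   fails. *)
rewrite [X in _ * X](_ : _ = 0) ?mulr0.
  apply: big1 => S /eqP; rewrite big1 => [/(congr1 (fun U => \dim U))|[]//].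
  by rewrite dimv0 dimV.
apply/eqP; rewrite eqz_nat cards_eq0; apply/eqP/setP => t.
by rewrite !inE.
Qed.

End Whitney.

(** * From ordered families to finite sets of points *)

Lemma finite_enum (T : eqType) (A : set T) : finite_set A ->
  exists n (f : 'I_n -> T), injective f /\ range f = A.
Proof.
move=> /finite_seqP[s ->]; exists (size (undup s)), (tnth (in_tuple (undup s))).
split; first by apply/tuple_uniqP/undup_uniq.
apply/seteqP; split=> [_ [i _ <-] /=|x /=].
  by rewrite -mem_undup; exact: mem_tnth.
by rewrite -mem_undup => /(tnthP (in_tuple (undup s)))[i ->]; exists i.
Qed.

Section EtaStar.
Variables (F : fieldType) (V : vectType F).

Lemma finite_enum_projSpace (H : set (projSpace V)) : finite_set H ->
  exists n (f : 'I_n -> projSpace V), injective f /\ range f = H.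
Proof. exact: (@finite_enum {L : {vspace V} | \dim L == 1%N}). Qed.

Lemma whitney_range (I J : finType) (p : I -> projSpace V) (p' : J -> projSpace V) :
    injective p' -> range p = range p' ->
  whitney (fun i => sval (p i)) = whitney (fun j => sval (p' j)).
Proof.
move=> p'_inj pp'.
have /choice[q qP] : forall i, exists j, p' j = p i.
  move=> i; have : range p (p i) by exists i.
  by rewrite pp' => -[j _ <-]; exists j.
rewrite -(@whitney_comp _ _ _ _ q).
  by congr (whitney _); apply/funext => i /=; rewrite qP.
move=> j; have : range p' (p' j) by exists j.
by rewrite -pp' => -[i _ pi]; exists i; apply: p'_inj; rewrite qP.
Qed.

(** The left side involves no order, so all orders of [range p] give the same count. Repetitions in
    [p] are allowed because projected points may coincide. *)
Lemma whitney_eta_star (m : nat) (I : finType) (p : I -> projSpace V) :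
  \dim {:V} = m.+1 ->
  whitney (fun i => sval (p i)) = (-1) ^+ m.+1 * (eta_star m (range p))%:Z.
Proof.
move=> dimV.
have etaE T (pi : 'I_T -> projSpace V) : set_bij setT (range p) pi ->
    whitney (fun i => sval (p i)) = (-1) ^+ m.+1 * #|eta_tuples m pi|%:Z.
  case=> pi_fun pi_inj pi_surj; rewrite -whitney_eta //; apply: whitney_range.
    by move=> i j; apply: pi_inj; rewrite in_setT.
  apply/seteqP; split; first exact: pi_surj.
  by move=> _ [i _ <-]; apply: pi_fun.
have [|T [pi [pi_inj piE]]] := @finite_enum_projSpace (range p).
  exact/finite_image/finite_finset.
have pi_bij : set_bij setT (range p) pi.
  by rewrite -piE; split=> [i _|i j _ _ /pi_inj//|]; [exists i|].
rewrite (etaE _ _ pi_bij) /eta_star; congr (_ * Posz _); apply/esym.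
have etaE' T' (pi' : 'I_T' -> projSpace V) : set_bij setT (range p) pi' ->
    #|eta_tuples m pi'| = #|eta_tuples m pi|.
  move=> pi'_bij; have := etaE _ _ pi'_bij; rewrite (etaE _ _ pi_bij).
  by move=> /(mulfI (negbT (signr_eq0 _ _)))[->].
(* The count is constant and attained by [pi], so [xget] returns it and not the default [0]. *)
by apply: xget_unique => [|k /(_ _ _ pi_bij) <-//]; exact: etaE'.
Qed.

(** Splits the sets by whether they contain [None]; adding [None] raises the cardinal by one, which
    gives the minus sign. *)
Lemma whitney_option (I : finType) (L : option I -> {vspace V}) :
  whitney L = whitney (fun i => L (Some i)) -
    \sum_(S : {set I} | (L None + \sum_(i in S) L (Some i))%VS == fullv)
      (-1) ^+ #|S|.
Proof.
have someI : injective (@Some I) by move=> ? ? [].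
have noneS (S : {set I}) : None \notin Some @: S by apply/imsetP => -[].
have sum_some (S : {set I}) :
    (\sum_(i in (Some @: S)%SET) L i = \sum_(i in S) L (Some i))%VS.
  by rewrite big_imset //= => ? ? _ _ /someI.
rewrite /whitney (bigID (fun S : {set option I} => None \notin S)) /=.
congr (_ + _).
  rewrite (reindex_onto (fun S : {set I} => Some @: S) (fun S => Some @^-1: S)) /=.
    apply: eq_big => [S|S _]; last by rewrite card_imset.
    rewrite sum_some noneS andbT; case: eqP => //= _.
    by apply/eqP/setP => i; rewrite inE mem_imset.
  move=> S /andP[_ nS]; apply/setP => -[i|]; first by rewrite mem_imset // inE.
  by rewrite (negbTE nS); apply/negbTE.
rewrite -sumrN.
rewrite (reindex_onto (fun S : {set I} => None |: (Some @: S))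
    (fun S => Some @^-1: S)) /=.
  apply: eq_big => [S|S _].
    rewrite big_setU1 //= sum_some !inE /= andbT; case: eqP => //= _.
    by apply/eqP/setP => i; rewrite !inE /= mem_imset.
  by rewrite cardsU1 noneS card_imset // exprS mulN1r.
move=> S /andP[_ /negPn nS]; apply/setP => -[i|]; last by rewrite !inE nS.
by rewrite !inE /= mem_imset // inE.
Qed.

End EtaStar.

(** * Orthogonal projection along [u] *)

Section OrthProj.
Variables (R : realFieldType) (n : nat) (u : 'rV[R]_n).
Hypothesis u0 : u != 0.

Lemma orth_proj_is_linear : linear (orth_proj u).
Proof.
move=> a x y; rewrite /orth_proj -linearP; congr (vsproj _ _).
have -> : dot (a *: x + y) u = a * dot x u + dot y u.
  by rewrite /dot mulmxDl -scalemxAl [LHS]mxE [X in X + _]mxE.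
rewrite mulrDl scalerDl.
by rewrite opprD scalerBr scalerA mulrA addrACA.
Qed.

HB.instance Definition _ := GRing.isLinear.Build R 'rV[R]_n (subvs_of (orth u))
  _ (orth_proj u) orth_proj_is_linear.

Let phi : 'Hom('rV[R]_n, subvs_of (orth u)) := linfun (orth_proj u).

Lemma dot_self_neq0 : dot u u != 0.
Proof.
apply: contraNneq u0; rewrite /dot mxE => /eqP.
rewrite psumr_eq0 => [/allP uu0|j _]; last by rewrite mxE -expr2 sqr_ge0.
apply/eqP/rowP => j; rewrite [RHS]mxE.
by have := uu0 j (mem_index_enum j); rewrite mxE mulf_eq0 orbb => /eqP.
Qed.

Lemma orth_proj_eq0 w : (orth_proj u w == 0) = (w \in <[u]>%VS).
Proof.
apply/eqP/vlineP => [/(congr1 vsval)|[a ->]].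
  rewrite vsval_orth_proj // => /eqP; rewrite raddf0 subr_eq0 => /eqP ->.
  by eexists.
by rewrite linearZ /= /orth_proj divff ?dot_self_neq0 // scale1r subrr linear0 scaler0.
Qed.

Lemma lker_orth_proj : lker phi = <[u]>%VS.
Proof. by apply/vspaceP => w; rewrite memv_ker lfunE orth_proj_eq0. Qed.

Lemma limg_orth_proj : limg phi = fullv.
Proof.
apply/eqP; rewrite eqEsubv subvf; apply/subvP => x _.
apply/memv_imgP; exists (vsval x); rewrite ?memvf // lfunE /= /orth_proj.
have /[!mem_orth] /eqP -> := subvsP x.
by rewrite mul0r scale0r subr0 vsvalK.
Qed.

(** Holds because [phi] is onto with kernel [<[u]>]. It turns spanning sets that contain [u] into
    spanning sets of the projected family. *)
Lemma limg_orth_proj_full (U : {vspace 'rV[R]_n}) :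
  (phi @: U == fullv)%VS = (<[u]> + U == fullv)%VS.
Proof.
apply/eqP/eqP => [Ufull|/(congr1 (lfun_img phi))]; last first.
  rewrite limg_orth_proj limgD limg_line.
  have /eqP -> : phi u == 0 by rewrite lfunE orth_proj_eq0 memv_line.
  by move=> <-; rewrite (_ : <[0]> = 0)%VS ?add0v //; apply/eqP; rewrite -subv0 -memvE mem0v.
apply/eqP; rewrite eqEsubv subvf; apply/subvP => w _.
have /memv_imgP[x xU wx] : phi w \in (phi @: U)%VS by rewrite Ufull memvf.
rewrite -[w](subrK x) memv_add // -lker_orth_proj memv_ker linearB /= wx.
by rewrite subrr.
Qed.

Lemma dim_orth : (\dim {:subvs_of (orth u)}).+1 = n.
Proof.
have := limg_ker_dim phi fullv; rewrite limg_orth_proj capfv lker_orth_proj.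
by rewrite dim_vline u0 add1n dimvf => ->; rewrite dimvf /dim /= mul1n.
Qed.

Lemma perp_range (T : Type) (pi : T -> projSpace 'rV[R]_n) :
    ~ range pi (line u0) ->
  exists q : T -> projSpace (subvs_of (orth u)),
    (forall i, sval (q i) = (phi @: sval (pi i))%VS) /\
    range q = perp (range pi) u.
Proof.
move=> piu.
(* A generator projecting to zero would lie on [<[u]>], making its point equal to [line u0]. *)
have q_neq0 i : orth_proj u (gen (pi i)) != 0.
  rewrite orth_proj_eq0 memvE -line_gen; apply/negP => piu'.
  apply: piu; exists i => //; apply: val_inj; apply/eqP => /=.
  by rewrite eqEdim piu' (eqP (svalP (pi i))) dim_vline u0.
pose q i := line (q_neq0 i).
have qE i : sval (q i) = (phi @: sval (pi i))%VS.
  by rewrite [in RHS]line_gen limg_line lfunE.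
exists q; split=> //; apply/seteqP; split=> [_ [i _ <-]|x [w [w0 [[i _ iw] xw]]]].
  exists (gen (pi i)), (gen_neq0 (pi i)); split=> //.
  by exists i => //; apply: val_inj; rewrite /= -line_gen.
exists i => //; apply: val_inj; rewrite /= xw; apply: (etrans (qE i)).
by rewrite iw limg_line lfunE.
Qed.

End OrthProj.

Theorem theorem1 (R : realType) (n : nat) (n_ge1 : (1 <= n)%N)
    (H : set (projSpace 'rV[R]_n.+1)) (finH : finite_set H)
    (u : 'rV[R]_n.+1) (u0 : u != 0) (uH : ~ H (line u0)) :
  eta_star n (H `|` [set line u0]) =
    (eta_star n H + eta_star n.-1 (perp H u))%N.
Proof.
have [T [pi [_ piE]]] := finite_enum_projSpace finH; rewrite -piE in uH *.
have [q [qE <-]] := perp_range uH.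
(* The added point takes the index [None], so that [whitney_option] separates the sets containing
   it. *)
pose piu : option 'I_T -> projSpace 'rV[R]_n.+1 := oapp pi (line u0).
have -> : range pi `|` [set line u0] = range piu.
  apply/seteqP; split=> [x [[i _ <-]|->]|_ [[i|] _ <-]].
  - by exists (Some i).
  - by exists None.
  - by left; exists i.
  - by right.
have dimV : \dim {:'rV[R]_n.+1} = n.+1 by rewrite dimvf /dim /= mul1n.
have dimW : \dim {:subvs_of (orth u)} = n.-1.+1.
  by rewrite prednK //; apply/eq_add_S/dim_orth.
have := whitney_option (fun i => sval (piu i)); rewrite /= !(@whitney_eta_star _ _ n) //.
have -> : \sum_(S : {set 'I_T} |
    (<[u]> + \sum_(i in S) sval (pi i) == fullv)%VS) (-1) ^+ #|S| =
    whitney (fun i => sval (q i)).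
  apply: eq_bigl => S; under [in RHS]eq_bigr do rewrite qE.
  by rewrite -limg_sum limg_orth_proj_full.
(* The complement has dimension [n], so its sign is [(-1) ^+ n]; the minus from the splitting makes
   it [(-1) ^+ n.+1], common to all three terms. *)
rewrite (whitney_eta_star _ dimW) prednK // -mulNr -[- _ ^+ n]mulN1r -exprS -mulrDr.
by move=> /(mulfI (negbT (signr_eq0 _ _)))[].
Qed.
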